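(* Let $K$ be a field. For each integer $n\geq 1$, $L_K(C_n^0)\cong L_K(1,2)$ as $K$-algebras.
   Context: For a directed graph $E=(E^0,E^1,r,s)$ and a field $K$, the Leavitt path algebra $L_K(E)$ is the $K$-algebra generated by $\{v\mid v\in E^0\}\cup\{e,e^*\mid e\in E^1\}$ subject to: (V) $vw=\delta_{v,w}v$ for $v,w\in E^0$; (E1) $s(e)e=er(e)=e$; (E2) $r(e)e^*=e^*s(e)=e^*$; (CK1) $e^*e'=\delta_{e,e'}r(e)$ for $e,e'\in E^1$; (CK2) $v=\sum_{\{e\in E^1\mid s(e)=v\}}ee^*$ for every $v\in E^0$ with $0<|s^{-1}(v)|<\infty$. $C_n^0$ is the directed graph with $n$ vertices $v_1,\dots,v_n$ and $2n$ edges $e_1,\dots,e_n,f_1,\dots,f_n$, where $e_i$ goes from $v_i$ to $v_{i+1}$ (subscripts mod $n$) and $f_i$ is a loop at $v_i$. The Leavitt algebra $L_K(1,m)$ ($m\ge 2$) is the free associative unital $K$-algebra in $2m$ generators $x_1,\dots,x_m,y_1,\dots,y_m$ modulo the relations $y_ix_k=\delta_{i,k}1_K$ and $\sum_{i=1}^m x_iy_i=1_K$. *)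

(* Defs.v *)
From HB Require Import structures.
From mathcomp Require Import all_boot all_order all_algebra.
From mathcomp Require Import boolp.

Set Implicit Arguments.
Unset Strict Implicit.
Unset Printing Implicit Defensive.

Import GRing.Theory.
Local Open Scope ring_scope.
Local Open Scope quotient_scope.

(* Associative algebras over a commutative ring, possibly without a unit: the
   Leavitt path algebra of a graph with infinitely many vertices has none, and
   MathComp's lalgType/algType require a unit (and 1 != 0). *)
HB.mixin Record Lmodule_isNuAlgebra (K : comPzRingType) A of GRing.Lmodule K A := {
  numul : A -> A -> A;
  numulA : associative numul;
  numulDl : left_distributive numul +%R;
  numulDr : right_distributive numul +%R;
  numulZl : forall (k : K) x y, numul (k *: x) y = k *: numul x y;
  numulZr : forall (k : K) x y, numul x (k *: y) = k *: numul x y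
}.

#[short(type="nuAlgType")]
HB.structure Definition NuAlgebra (K : comPzRingType) :=
  {A of GRing.Lmodule K A & Lmodule_isNuAlgebra K A}.

(* When A or B has a unit, such an f automatically matches the units. *)
Definition alg_isomorphic (K : comPzRingType) (A B : nuAlgType K) : Prop :=
  exists f : {linear A -> B},
    bijective f /\ forall x y : A, f (numul x y) = numul (f x) (f y).

(* Presentations by generators and relations.  [term K X u] is the type of
   formal algebra expressions in the generators X; the constant [One] is only
   available in the unital signature (u = true).  [cong R] is the least
   congruence containing R and the axioms of associative (unital, if u = true)
   K-algebras, so the quotient is the free such algebra on X modulo the
   two-sided ideal generated by the differences s - t with R s t. *)
Inductive term (K X : Type) (u : bool) : Type :=
| Gen of X
| One of u
| Zero
| Opp of term K X u
| Add of term K X u & term K X u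
| Scale of K & term K X u
| Mul of term K X u & term K X u.

Arguments Gen {K X u} x.
Arguments One {K X u} hu.
Arguments Zero {K X u}.

Section Presentation.
Variables (K : fieldType) (X : Type) (u : bool).
Local Notation tm := (term K X u).

Inductive cong (R : tm -> tm -> Prop) : tm -> tm -> Prop :=
| cong_rel s t : R s t -> cong R s t
| cong_refl t : cong R t t
| cong_sym s t : cong R s t -> cong R t s
| cong_trans s t w : cong R s t -> cong R t w -> cong R s w
| cong_Opp s t : cong R s t -> cong R (Opp s) (Opp t)
| cong_Add s t s' t' :
    cong R s t -> cong R s' t' -> cong R (Add s s') (Add t t')
| cong_Scale k s t : cong R s t -> cong R (Scale k s) (Scale k t)
| cong_Mul s t s' t' :
    cong R s t -> cong R s' t' -> cong R (Mul s s') (Mul t t')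
| cong_addA r s t : cong R (Add r (Add s t)) (Add (Add r s) t)
| cong_addC s t : cong R (Add s t) (Add t s)
| cong_add0 t : cong R (Add Zero t) t
| cong_addN t : cong R (Add (Opp t) t) Zero
| cong_scaleA a b t : cong R (Scale a (Scale b t)) (Scale (a * b) t)
| cong_scale1 t : cong R (Scale 1 t) t
| cong_scaleDr a s t : cong R (Scale a (Add s t)) (Add (Scale a s) (Scale a t))
| cong_scaleDl a b t : cong R (Scale (a + b) t) (Add (Scale a t) (Scale b t))
| cong_mulA r s t : cong R (Mul r (Mul s t)) (Mul (Mul r s) t)
| cong_mulDl r s t : cong R (Mul (Add r s) t) (Add (Mul r t) (Mul s t))
| cong_mulDr r s t : cong R (Mul r (Add s t)) (Add (Mul r s) (Mul r t))
| cong_mulZl a s t : cong R (Mul (Scale a s) t) (Scale a (Mul s t))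
| cong_mulZr a s t : cong R (Mul s (Scale a t)) (Scale a (Mul s t))
| cong_mul1l (hu : u) t : cong R (Mul (One hu) t) t
| cong_mul1r (hu : u) t : cong R (Mul t (One hu)) t.

HB.instance Definition _ := gen_eqMixin tm.
HB.instance Definition _ := gen_choiceMixin tm.

Variable R : tm -> tm -> Prop.

Definition congb (s t : tm) : bool := `[< cong R s t >].

Lemma congb_refl : reflexive congb.
Proof. by move=> t; apply/asboolP; exact: cong_refl. Qed.

Lemma congb_sym : symmetric congb.
Proof. by move=> s t; apply/asboolP/asboolP; exact: cong_sym. Qed.

Lemma congb_trans : transitive congb.
Proof.
move=> t s w /asboolP st /asboolP tw; apply/asboolP; exact: cong_trans st tw.
Qed.

Canonical congb_equiv := EquivRel congb congb_refl congb_sym congb_trans.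

Definition presented := {eq_quot congb_equiv}.

HB.instance Definition _ := Choice.on presented.
HB.instance Definition _ := EqQuotient.on presented.

Definition pclass (t : tm) : presented := \pi_presented t.

Lemma pclassP s t : pclass s = pclass t <-> cong R s t.
Proof.
split=> [h|h]; first by apply/asboolP; move/eqmodP: h.
by apply/eqmodP/asboolP.
Qed.

Lemma pclassK (x : presented) : pclass (repr x) = x.
Proof. exact: reprK. Qed.

Lemma pclass_ind (P : presented -> Prop) : (forall t, P (pclass t)) -> forall x, P x.
Proof. by move=> h x; rewrite -(pclassK x). Qed.

Lemma repr_pclass t : cong R (repr (pclass t)) t.
Proof. by apply/pclassP; rewrite pclassK. Qed.

Definition pzero : presented := pclass Zero.
Definition popp (x : presented) : presented := pclass (Opp (repr x)).
Definition padd (x y : presented) : presented := pclass (Add (repr x) (repr y)).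
Definition pscale (k : K) (x : presented) : presented := pclass (Scale k (repr x)).
Definition pmul (x y : presented) : presented := pclass (Mul (repr x) (repr y)).

Lemma pclass_opp t : popp (pclass t) = pclass (Opp t).
Proof. by apply/pclassP/cong_Opp/repr_pclass. Qed.

Lemma pclass_add s t : padd (pclass s) (pclass t) = pclass (Add s t).
Proof. by apply/pclassP/cong_Add; exact: repr_pclass. Qed.

Lemma pclass_scale k t : pscale k (pclass t) = pclass (Scale k t).
Proof. by apply/pclassP/cong_Scale/repr_pclass. Qed.

Lemma pclass_mul s t : pmul (pclass s) (pclass t) = pclass (Mul s t).
Proof. by apply/pclassP/cong_Mul; exact: repr_pclass. Qed.

Lemma paddA : associative padd.
Proof.
elim/pclass_ind=> r; elim/pclass_ind=> s; elim/pclass_ind=> t.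
by rewrite !pclass_add; apply/pclassP/cong_addA.
Qed.

Lemma paddC : commutative padd.
Proof.
elim/pclass_ind=> s; elim/pclass_ind=> t.
by rewrite !pclass_add; apply/pclassP/cong_addC.
Qed.

Lemma padd0 : left_id pzero padd.
Proof. by elim/pclass_ind=> t; rewrite pclass_add; apply/pclassP/cong_add0. Qed.

Lemma paddN : left_inverse pzero popp padd.
Proof.
by elim/pclass_ind=> t; rewrite pclass_opp pclass_add; apply/pclassP/cong_addN.
Qed.

HB.instance Definition _ :=
  GRing.isZmodule.Build presented paddA paddC padd0 paddN.

Lemma addE (x y : presented) : x + y = padd x y.
Proof. by []. Qed.

Lemma pscaleA a b x : pscale a (pscale b x) = pscale (a * b) x.
Proof.
by elim/pclass_ind: x => t; rewrite !pclass_scale; apply/pclassP/cong_scaleA.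
Qed.

Lemma pscale1 : left_id 1 pscale.
Proof. by elim/pclass_ind=> t; rewrite pclass_scale; apply/pclassP/cong_scale1. Qed.

Lemma pscaleDr : right_distributive pscale +%R.
Proof.
move=> a; elim/pclass_ind=> s; elim/pclass_ind=> t.
by rewrite !(addE, pclass_scale, pclass_add); apply/pclassP/cong_scaleDr.
Qed.

Lemma pscaleDl x : {morph pscale^~ x : a b / a + b}.
Proof.
move=> a b; elim/pclass_ind: x => t.
by rewrite addE !pclass_scale pclass_add; apply/pclassP/cong_scaleDl.
Qed.

HB.instance Definition _ := GRing.Zmodule_isLmodule.Build K presented
  pscaleA pscale1 pscaleDr pscaleDl.

Lemma scaleE (k : K) (x : presented) : k *: x = pscale k x.
Proof. by []. Qed.

Lemma pmulA : associative pmul.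
Proof.
elim/pclass_ind=> r; elim/pclass_ind=> s; elim/pclass_ind=> t.
by rewrite !pclass_mul; apply/pclassP/cong_mulA.
Qed.

Lemma pmulDl : left_distributive pmul +%R.
Proof.
elim/pclass_ind=> r; elim/pclass_ind=> s; elim/pclass_ind=> t.
by rewrite !(addE, pclass_mul, pclass_add); apply/pclassP/cong_mulDl.
Qed.

Lemma pmulDr : right_distributive pmul +%R.
Proof.
elim/pclass_ind=> r; elim/pclass_ind=> s; elim/pclass_ind=> t.
by rewrite !(addE, pclass_mul, pclass_add); apply/pclassP/cong_mulDr.
Qed.

Lemma pmulZl (k : K) x y : pmul (k *: x) y = k *: pmul x y.
Proof.
elim/pclass_ind: x => s; elim/pclass_ind: y => t.
by rewrite !(scaleE, pclass_scale, pclass_mul); apply/pclassP/cong_mulZl.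
Qed.

Lemma pmulZr (k : K) x y : pmul x (k *: y) = k *: pmul x y.
Proof.
elim/pclass_ind: x => s; elim/pclass_ind: y => t.
by rewrite !(scaleE, pclass_scale, pclass_mul); apply/pclassP/cong_mulZr.
Qed.

HB.instance Definition _ := Lmodule_isNuAlgebra.Build K presented
  pmulA pmulDl pmulDr pmulZl pmulZr.

End Presentation.

(* A directed graph; vertex and edge sets may be infinite. *)
Record digraph := Digraph {
  vertex : eqType;
  edge : eqType;
  src : edge -> vertex;
  tgt : edge -> vertex
}.

Inductive lpa_gen (E : digraph) : Type :=
| Vert of vertex E
| Edge of edge E
| Ghost of edge E.

Section LeavittPathAlgebra.
Variables (K : fieldType) (E : digraph).

Local Notation tm := (term K (lpa_gen E) false).

Inductive lpa_rel : tm -> tm -> Prop :=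
| lpa_V v w :
    lpa_rel (Mul (Gen (Vert v)) (Gen (Vert w)))
            (if v == w then Gen (Vert v) else Zero)
| lpa_E1s e :
    lpa_rel (Mul (Gen (Vert (src e))) (Gen (Edge e))) (Gen (Edge e))
| lpa_E1r e :
    lpa_rel (Mul (Gen (Edge e)) (Gen (Vert (tgt e)))) (Gen (Edge e))
| lpa_E2r e :
    lpa_rel (Mul (Gen (Vert (tgt e))) (Gen (Ghost e))) (Gen (Ghost e))
| lpa_E2s e :
    lpa_rel (Mul (Gen (Ghost e)) (Gen (Vert (src e)))) (Gen (Ghost e))
| lpa_CK1 e e' :
    lpa_rel (Mul (Gen (Ghost e)) (Gen (Edge e')))
            (if e == e' then Gen (Vert (tgt e)) else Zero)
(* A duplicate-free nonempty list es enumerating s^-1(v) exists exactly when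
   0 < |s^-1(v)| < oo. *)
| lpa_CK2 v (es : seq (edge E)) :
    uniq es -> es <> [::] -> (forall e, (e \in es) = (src e == v)) ->
    lpa_rel (Gen (Vert v))
            (\big[@Add K (lpa_gen E) false/Zero]_(e <- es)
               Mul (Gen (Edge e)) (Gen (Ghost e))).

Definition leavitt_path_algebra : nuAlgType K := presented lpa_rel.

End LeavittPathAlgebra.

(* The vertices v_1, ..., v_n are 'I_n; inl i is e_i and inr i is f_i.
   [ordS i] is i + 1 modulo n. *)
Definition C0 (n : nat) : digraph := {|
  vertex := 'I_n;
  edge := ('I_n + 'I_n)%type;
  src := fun e => match e with inl i => i | inr i => i end;
  tgt := fun e => match e with inl i => ordS i | inr i => i end
|}.

Section LeavittAlgebra.
Variables (K : fieldType) (m : nat).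

(* inl i is x_i and inr i is y_i. *)
Local Notation tm := (term K ('I_m + 'I_m) true).

Inductive leavitt_rel : tm -> tm -> Prop :=
| leavitt_yx i k :
    leavitt_rel (Mul (Gen (inr i)) (Gen (inl k)))
                (if i == k then One isT else Zero)
| leavitt_xy :
    leavitt_rel (\big[@Add K ('I_m + 'I_m) true/Zero]_(i < m)
                   Mul (Gen (inl i)) (Gen (inr i)))
                (One isT).

Definition leavitt_algebra : nuAlgType K := presented leavitt_rel.

End LeavittAlgebra.

(* Main.v *)
From HB Require Import structures.
Require Import Defs.
From mathcomp Require Import all_boot all_order all_algebra.

(** Write the vertices of the graph as 0, ..., N, so that the relations at a
vertex l say that the module v_l is isomorphic to v_l + v_{l+1} (subscripts
mod N + 1), the isomorphism being the row (f_l, e_l).  These relations force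
all the v_l to be isomorphic.  Indeed, if v_l is already identified with v_0,
there is a chain of isomorphisms
  v_l ~ v_l + v_{l+1} ~ v_l + v_{l+1} + ... + v_N ~ v_{l+1} + ... + v_N
      ~ v_{l+1},
where the second and the last step expand and contract v_{l+1} through the
relations at l+1, ..., N-1, and the third one absorbs v_l = v_0 into v_N by
the relation at N.  The relation at l enters the chain only once, so that it
carries the same information as the resulting isomorphism of v_l with v_{l+1}.
Using this for l = 0, ..., N-1, one trades all the relations but the last for
identifications of the v_l with one module v, and the last relation becomes
v ~ v + v, which presents the Leavitt algebra L(1,2).  Hence the Leavitt path
algebra is the algebra of (N+1) x (N+1) matrices over L(1,2), and this matrix
algebra is L(1,2) again, because v ~ v + v gives v ~ v^(N+1).

The proof makes this explicit.  In every family satisfying the relations of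
the graph, [munit l] and [munit' l] are the matrix units E_{0,l} and E_{l,0}
given by the chains above ([munit_mvn]); the corner at v_0 contains a
Leavitt family ([corner_family]), hence an image [chi] of L(1,2), and the
entries of the matrices that represent e_l and f_l are the images of the
explicit elements [coef] of L(1,2) ([chi_coef]): x1 and x0 for l = N, and
  e_l : 1 - x0^k y0^k + x0^(k+1) y0^k,     f_l : x0^k x1,     k = N - 1 - l,
for l < N.  Conversely, these elements, spread over L(1,2) by the prefix code
x1, x0 x1, ..., x0^(N-1) x1, x0^N, satisfy the relations of the graph
([code_family]), which gives a map [phi] from the Leavitt path algebra to
L(1,2).  Then [chi_phi] and [phi_chi] say that [phi] and [chi] are inverse to
each other up to the matrix units, and this yields the inverse of [phi]
([phi_bijective]). *)

Set Implicit Arguments.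
Unset Strict Implicit.
Unset Printing Implicit Defensive.

Import GRing.Theory.
Local Open Scope ring_scope.

Local Notation "x ** y" := (numul x y) (at level 40, left associativity).

(** * Algebras without unit *)

Section NonUnitalAlgebra.
Variables (K : comPzRingType) (A : nuAlgType K).
Implicit Types a b c t : A.

Lemma numul0 a : a ** 0 = 0.
Proof. by rewrite -(scale0r 0) numulZr !scale0r. Qed.

Lemma nu0mul a : 0 ** a = 0.
Proof. by rewrite -(scale0r 0) numulZl !scale0r. Qed.

Lemma numulN a b : a ** (- b) = - (a ** b).
Proof. by rewrite -scaleN1r numulZr scaleN1r. Qed.

Lemma nuNmul a b : (- a) ** b = - (a ** b).
Proof. by rewrite -scaleN1r numulZl scaleN1r. Qed.

Lemma numulBr a b c : a ** (b - c) = a ** b - a ** c.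
Proof. by rewrite numulDr numulN. Qed.

Lemma numulBl a b c : (a - b) ** c = a ** c - b ** c.
Proof. by rewrite numulDl nuNmul. Qed.

Lemma numul_sumr I (r : seq I) (P : pred I) a (F : I -> A) :
  a ** (\sum_(i <- r | P i) F i) = \sum_(i <- r | P i) a ** F i.
Proof. by apply: (big_morph (numul a)) => [b c|]; rewrite ?numul0 ?numulDr. Qed.

Lemma numul_suml I (r : seq I) (P : pred I) a (F : I -> A) :
  (\sum_(i <- r | P i) F i) ** a = \sum_(i <- r | P i) F i ** a.
Proof.
by apply: (big_morph (numul^~ a)) => [b c|]; rewrite ?nu0mul ?numulDl.
Qed.

(** Lets a relation [a ** b = c] act at the head of a product that is
associated to the right. *)
Lemma numul_head a b c : a ** b = c -> forall t, a ** (b ** t) = c ** t.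
Proof. by move=> <- t; rewrite numulA. Qed.

End NonUnitalAlgebra.

Definition multiplicative_map (K : comPzRingType) (A B : nuAlgType K)
  (f : A -> B) := {morph f : x y / x ** y}.

(** * The universal property of a presentation *)

Section UniversalProperty.
Variables (K : fieldType) (X : Type) (u : bool) (B : nuAlgType K).
(* The image [one] of the unit is only required to be a unit for the images of
   the generators: the target may be a corner of [B]. *)
Variables (gen : X -> B) (one : B).

Fixpoint eval (t : term K X u) : B :=
  match t with
  | Gen x => gen x
  | One _ => one
  | Zero => 0
  | Opp s => - eval s
  | Add s s' => eval s + eval s'
  | Scale k s => k *: eval s
  | Mul s s' => eval s ** eval s'
  end.

Lemma eval_sum I (r : seq I) (F : I -> term K X u) :
  eval (\big[@Add K X u/Zero]_(i <- r) F i) = \sum_(i <- r) eval (F i).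
Proof. by elim: r => [|i r IH]; rewrite ?big_nil // !big_cons /= IH. Qed.

Hypothesis one_idem : u -> one ** one = one.
Hypothesis one_gen : u -> forall x, one ** gen x = gen x /\ gen x ** one = gen x.

Lemma eval_unit (hu : u) t : one ** eval t = eval t /\ eval t ** one = eval t.
Proof.
elim: t => [x|h||s [sl sr]|s [sl sr] t [tl tr]|k s [sl sr]|s [sl sr] t [tl tr]] /=.
- exact: one_gen.
- by rewrite one_idem.
- by rewrite numul0 nu0mul.
- by rewrite numulN nuNmul sl sr.
- by rewrite numulDl numulDr sl sr tl tr.
- by rewrite numulZl numulZr sl sr.
- by rewrite numulA sl -numulA tr.
Qed.

Variable R : term K X u -> term K X u -> Prop.
Hypothesis evalR : forall s t, R s t -> eval s = eval t.

Lemma eval_cong s t : cong R s t -> eval s = eval t.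
Proof.
elim=> //=; try by move=> *; congruence.
- by move=> *; rewrite addrA.
- by move=> *; rewrite addrC.
- by move=> *; rewrite add0r.
- by move=> *; rewrite addNr.
- by move=> *; rewrite scalerA.
- by move=> *; rewrite scale1r.
- by move=> *; rewrite scalerDr.
- by move=> *; rewrite scalerDl.
- by move=> *; rewrite numulA.
- by move=> *; rewrite numulDl.
- by move=> *; rewrite numulDr.
- by move=> *; rewrite numulZl.
- by move=> *; rewrite numulZr.
- by move=> hu r; have [] := eval_unit hu r.
- by move=> hu r; have [] := eval_unit hu r.
Qed.

Lemma presented_lift : exists f : {linear presented R -> B},
  multiplicative_map f /\ forall t, f (pclass R t) = eval t.
Proof.
pose f (x : presented R) := eval (repr x).
have fE t : f (pclass R t) = eval t by apply: eval_cong; exact: repr_pclass.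
have fD : linear f.
  move=> k; elim/pclass_ind=> s; elim/pclass_ind=> t.
  by rewrite scaleE addE pclass_scale pclass_add !fE.
pose mx := GRing.isLinear.Build K (presented R) B *:%R f fD.
pose F : {linear presented R -> B} := HB.pack f mx.
exists F; split=> //.
elim/pclass_ind=> s; elim/pclass_ind=> t.
by rewrite /= [pclass _ _ ** _]pclass_mul !fE.
Qed.

End UniversalProperty.

(** * Twisting along an isometry *)

Section Twist.
Variables (K : comPzRingType) (A : nuAlgType K).

(** If [z], [z'] is an isometry onto a direct summand of the corner of the
idempotent [w], this is the element of the corner that acts as [a] on the
summand and as the identity on its complement. *)
Definition twist (w z z' a : A) := w - z ** z' + z ** a ** z'.

Variables (w z z' p : A).
Hypotheses (ww : w ** w = w) (wz : w ** z = z) (z'w : z' ** w = z')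
           (z'z : z' ** z = p) (zp : z ** p = z) (pz' : p ** z' = z').

(* The complement of the summand. *)
Let r := w - z ** z'.

Let rr : r ** r = r.
Proof.
rewrite /r numulBr !numulBl ww -[z ** z' ** w]numulA z'w numulA wz.
by rewrite [z ** z' ** _]numulA -[z ** z' ** z]numulA z'z zp subrr subr0.
Qed.

Let rz : r ** z = 0.
Proof. by rewrite /r numulBl wz -numulA z'z zp subrr. Qed.

Let z'r : z' ** r = 0.
Proof. by rewrite /r numulBr z'w numulA z'z pz' subrr. Qed.

Lemma twistl a : twist w z z' a ** z = z ** a ** p.
Proof. by rewrite /twist numulDl rz add0r -numulA z'z. Qed.

Lemma twistr a : z' ** twist w z z' a = p ** a ** z'.
Proof. by rewrite /twist numulDr z'r add0r !numulA z'z. Qed.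

Lemma twistM a b : a ** p = a -> twist w z z' a ** twist w z z' b = twist w z z' (a ** b).
Proof.
move=> ap.
have tr : twist w z z' a ** r = r.
  by rewrite numulDl -/r rr -numulA z'r numul0 addr0.
rewrite [in LHS](_ : twist w z z' b = r + z ** b ** z') // numulDr tr.
by rewrite !numulA twistl -(numulA z) ap /twist !numulA.
Qed.

Lemma twistD a b : twist w z z' a + z ** b ** z' = twist w z z' (a + b).
Proof. by rewrite /twist numulDr numulDl addrA. Qed.

Lemma twist_id : twist w z z' p = w.
Proof. by rewrite /twist zp subrK. Qed.

Lemma wtwist a : w ** twist w z z' a = twist w z z' a.
Proof. by rewrite /twist numulDr numulBr ww !numulA wz. Qed.

Lemma twistw a : twist w z z' a ** w = twist w z z' a.
Proof. by rewrite /twist numulDl numulBl ww -!numulA z'w. Qed.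

End Twist.

(** Twists are compatible with a change of corners, along [s], [s'] for the
corner of [w] and along [t], [t'] for the source of the isometry. *)
Lemma twist_conj (K : comPzRingType) (A : nuAlgType K) (s s' t t' w z z' a : A) :
  z ** (t' ** t) = z -> a ** (t' ** t) = a ->
  twist (s ** w ** s') (s ** z ** t') (t ** z' ** s') (t ** a ** t') =
  s ** twist w z z' a ** s'.
Proof.
move=> zt at'; rewrite /twist numulDr numulDl numulBr numulBl.
congr (_ - _ + _); rewrite !numulA -!(numulA _ t' t) -(numulA _ z) zt //.
by rewrite -(numulA _ a) at'.
Qed.

(** A row (e, f) and a column (a, b) that are both invertible, with inverses
made of the primed elements, have an invertible product [e ** a + f ** b]. *)
Section UnitaryProduct.
Variables (K : comPzRingType) (A : nuAlgType K).
Variables (v w e e' f f' a a' b b' : A).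

Lemma row_column_mul :
  e' ** e = w -> f' ** f = v -> e' ** f = 0 -> f' ** e = 0 ->
  w ** a = a -> v ** b = b -> a' ** a + b' ** b = w ->
  (a' ** e' + b' ** f') ** (e ** a + f ** b) = w.
Proof.
move=> ee ff ef fe wa vb <-; rewrite numulDr !numulDl -!numulA.
rewrite (numul_head ee) (numul_head fe) (numul_head ef) (numul_head ff).
by rewrite !nu0mul !numul0 wa vb addr0 add0r.
Qed.

Lemma column_row_mul :
  e ** w = e -> f ** v = f -> e ** e' + f ** f' = v ->
  a ** a' = w -> b ** b' = v -> a ** b' = 0 -> b ** a' = 0 ->
  (e ** a + f ** b) ** (a' ** e' + b' ** f') = v.
Proof.
move=> ew fv ck aa bb ab ba; rewrite numulDr !numulDl -!numulA.
rewrite (numul_head aa) (numul_head ab) (numul_head ba) (numul_head bb).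
by rewrite !nu0mul !numul0 (numulA e) ew (numulA f) fv addr0 add0r.
Qed.
End UnitaryProduct.

(** * Leavitt families and Leavitt path families *)

(** Images of the generators of L(1,m) in the corner of an idempotent [o]. *)
Record leavitt_family (K : comPzRingType) (A : nuAlgType K) m
    (x y : 'I_m -> A) (o : A) : Prop := {
  lfam_yx : forall i k, y i ** x k = if i == k then o else 0;
  lfam_xy : \sum_(i < m) x i ** y i = o;
  lfam_xo : forall i, x i ** o = x i;
  lfam_oy : forall i, o ** y i = y i
}.

Section LeavittFamily.
Variables (K : comPzRingType) (A : nuAlgType K) (m : nat).
Variables (x y : 'I_m -> A) (o : A).
Hypothesis fam : leavitt_family x y o.

Lemma lfam_ox i : o ** x i = x i.
Proof.
rewrite -(lfam_xy fam) numul_suml (bigD1 i) //= big1 ?addr0 => [|k ki].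
  by rewrite -numulA (lfam_yx fam) eqxx (lfam_xo fam).
by rewrite -numulA (lfam_yx fam) (negbTE ki) numul0.
Qed.

Lemma lfam_yo i : y i ** o = y i.
Proof.
rewrite -(lfam_xy fam) numul_sumr (bigD1 i) //= big1 ?addr0 => [|k ki].
  by rewrite numulA (lfam_yx fam) eqxx (lfam_oy fam).
by rewrite numulA (lfam_yx fam) eq_sym (negbTE ki) nu0mul.
Qed.

Lemma lfam_oo : o ** o = o.
Proof.
rewrite -{2}(lfam_xy fam) numul_sumr -[RHS](lfam_xy fam).
by apply: eq_bigr => i _; rewrite numulA lfam_ox.
Qed.

End LeavittFamily.

Section LeavittUniversal.
Variables (K : fieldType) (m : nat).

Definition lv_x (i : 'I_m) : leavitt_algebra K m :=
  pclass (@leavitt_rel K m) (Gen (inl i)).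
Definition lv_y (i : 'I_m) : leavitt_algebra K m :=
  pclass (@leavitt_rel K m) (Gen (inr i)).
Definition lv_1 : leavitt_algebra K m := pclass (@leavitt_rel K m) (One isT).

Lemma pclass_sum (X : Type) u (R : term K X u -> term K X u -> Prop) I
    (r : seq I) (F : I -> term K X u) :
  pclass R (\big[@Add K X u/Zero]_(i <- r) F i) = \sum_(i <- r) pclass R (F i).
Proof.
elim: r => [|i r IH]; rewrite ?big_nil // !big_cons.
by rewrite -IH addE pclass_add.
Qed.

Lemma pclassM (X : Type) u (R : term K X u -> term K X u -> Prop) s t :
  pclass R (Mul s t) = (pclass R s : presented R) ** pclass R t.
Proof. by symmetry; exact: pclass_mul. Qed.

Lemma lv_mul1l (t : leavitt_algebra K m) : lv_1 ** t = t.
Proof.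
by elim/pclass_ind: t => t; rewrite -pclassM; apply/pclassP/cong_mul1l.
Qed.

Lemma lv_mul1r (t : leavitt_algebra K m) : t ** lv_1 = t.
Proof.
by elim/pclass_ind: t => t; rewrite -pclassM; apply/pclassP/cong_mul1r.
Qed.

Lemma lv_family : leavitt_family lv_x lv_y lv_1.
Proof.
split=> [i k||i|i]; rewrite ?lv_mul1l ?lv_mul1r //.
- rewrite -pclassM.
  have -> : pclass (@leavitt_rel K m) (Mul (Gen (inr i)) (Gen (inl k))) =
    pclass (@leavitt_rel K m) (if i == k then One isT else Zero).
    by apply/pclassP/cong_rel; constructor.
  by case: (i == k).
- under eq_bigr do rewrite -pclassM.
  by rewrite -pclass_sum; apply/pclassP/cong_rel; constructor.
Qed.

Lemma leavitt_ind (P : leavitt_algebra K m -> Prop) :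
  (forall i, P (lv_x i)) -> (forall i, P (lv_y i)) -> P lv_1 ->
  (forall a b, P a -> P b -> P (a + b)) -> (forall k a, P a -> P (k *: a)) ->
  (forall a b, P a -> P b -> P (a ** b)) ->
  forall a, P a.
Proof.
move=> Px Py P1 PD PZ PM; elim/pclass_ind; elim.
- by case=> i; [exact: Px | exact: Py].
- by move=> hu; rewrite (bool_irrelevance hu isT).
- by have := PZ 0 _ P1; rewrite scale0r.
- by move=> t /(PZ (-1)); rewrite scaleN1r -[- _]/(popp _) pclass_opp.
- by move=> s Ps t Pt; have := PD _ _ Ps Pt; rewrite addE pclass_add.
- by move=> k t /(PZ k); rewrite scaleE pclass_scale.
- by move=> s Ps t Pt; rewrite pclassM; exact: PM.
Qed.

Lemma leavitt_lift (A : nuAlgType K) (x y : 'I_m -> A) o :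
  leavitt_family x y o ->
  exists f : {linear leavitt_algebra K m -> A}, [/\ multiplicative_map f,
    f lv_1 = o, forall i, f (lv_x i) = x i & forall i, f (lv_y i) = y i].
Proof.
move=> fam.
pose gen (t : 'I_m + 'I_m) := match t with inl i => x i | inr i => y i end.
have [_|_ [i|i]|s t|f [fM fE]] := @presented_lift K _ true A gen o _ _ (@leavitt_rel K m).
- exact: lfam_oo fam.
- by rewrite /= (lfam_ox fam) (lfam_xo fam).
- by rewrite /= (lfam_oy fam) (lfam_yo fam).
- case=> [i k|] /=; first by rewrite (lfam_yx fam); case: (i == k).
  by rewrite eval_sum -(lfam_xy fam).
by exists f; split=> // [|i|i]; rewrite fE.
Qed.

End LeavittUniversal.

Record lpa_family (K : comPzRingType) (A : nuAlgType K) (E : digraph)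
    (v : vertex E -> A) (e g : edge E -> A) : Prop := {
  gfam_vv : forall i j, v i ** v j = if i == j then v i else 0;
  gfam_ve : forall a, v (src a) ** e a = e a;
  gfam_ev : forall a, e a ** v (tgt a) = e a;
  gfam_vg : forall a, v (tgt a) ** g a = g a;
  gfam_gv : forall a, g a ** v (src a) = g a;
  gfam_ge : forall a b, g a ** e b = if a == b then v (tgt a) else 0;
  gfam_ck2 : forall i (s : seq (edge E)), uniq s -> s <> [::] ->
    (forall a, (a \in s) = (src a == i)) -> v i = \sum_(a <- s) e a ** g a
}.

Section LeavittPathUniversal.
Variables (K : fieldType) (E : digraph).

Local Notation L := (leavitt_path_algebra K E).

Definition lpa_v i : L := pclass (@lpa_rel K E) (Gen (Vert i)).
Definition lpa_e a : L := pclass (@lpa_rel K E) (Gen (Edge a)).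
Definition lpa_g a : L := pclass (@lpa_rel K E) (Gen (Ghost a)).

Lemma lpa_family_gen : lpa_family lpa_v lpa_e lpa_g.
Proof.
have rel s t : lpa_rel s t -> pclass (@lpa_rel K E) s = pclass (@lpa_rel K E) t.
  by move=> h; apply/pclassP/cong_rel.
split=> [i j|a|a|a|a|a b|i s us s0 sE]; rewrite -?pclassM.
- by rewrite (rel _ _ (lpa_V _ _ _)); case: (i == j).
- by rewrite (rel _ _ (lpa_E1s _ _)).
- by rewrite (rel _ _ (lpa_E1r _ _)).
- by rewrite (rel _ _ (lpa_E2r _ _)).
- by rewrite (rel _ _ (lpa_E2s _ _)).
- by rewrite (rel _ _ (lpa_CK1 _ _ _)); case: (a == b).
- under eq_bigr do rewrite -pclassM.
  by rewrite -pclass_sum; apply: rel; constructor.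
Qed.

Lemma lpa_ind (P : L -> Prop) :
  (forall i, P (lpa_v i)) -> (forall a, P (lpa_e a)) ->
  (forall a, P (lpa_g a)) -> P 0 ->
  (forall a b, P a -> P b -> P (a + b)) -> (forall k a, P a -> P (k *: a)) ->
  (forall a b, P a -> P b -> P (a ** b)) ->
  forall a, P a.
Proof.
move=> Pv Pe Pg P0 PD PZ PM; elim/pclass_ind; elim=> //.
- by case=> i; [exact: Pv | exact: Pe | exact: Pg].
- by move=> t /(PZ (-1)); rewrite scaleN1r -[- _]/(popp _) pclass_opp.
- by move=> s Ps t Pt; have := PD _ _ Ps Pt; rewrite addE pclass_add.
- by move=> k t /(PZ k); rewrite scaleE pclass_scale.
- by move=> s Ps t Pt; rewrite pclassM; exact: PM.
Qed.

Lemma lpa_lift (A : nuAlgType K) (v : vertex E -> A) (e g : edge E -> A) :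
  lpa_family v e g ->
  exists f : {linear L -> A}, [/\ multiplicative_map f,
    forall i, f (lpa_v i) = v i, forall a, f (lpa_e a) = e a &
    forall a, f (lpa_g a) = g a].
Proof.
move=> fam.
pose gen (t : lpa_gen E) :=
  match t with Vert i => v i | Edge a => e a | Ghost a => g a end.
have [||s t|f [fM fE]] := @presented_lift K _ false A gen 0 _ _ (@lpa_rel K E) => //.
- case=> [i j|a|a|a|a|a b|i es us s0 sE] /=.
  + by rewrite (gfam_vv fam); case: (i == j).
  + exact: gfam_ve fam a.
  + exact: gfam_ev fam a.
  + exact: gfam_vg fam a.
  + exact: gfam_gv fam a.
  + by rewrite (gfam_ge fam); case: (a == b).
  + by rewrite eval_sum; exact: gfam_ck2 fam _ _ us s0 sE.
by exists f; split=> // [i|a|a]; rewrite fE.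
Qed.

End LeavittPathUniversal.

(** * Matrix units in a family over the cycle with loops *)

Section MatrixUnits.
Variables (K : comPzRingType) (A : nuAlgType K) (N : nat).
Local Notation C := (C0 N.+1).
Variables (v : vertex C -> A) (ed gh : edge C -> A).

Local Notation V l := (v (inord l)).
Local Notation E l := (ed (inl (inord l))).
Local Notation E' l := (gh (inl (inord l))).
Local Notation F l := (ed (inr (inord l))).
Local Notation F' l := (gh (inr (inord l))).

(** The path from vertex N - k to vertex N along the cycle. *)
Fixpoint last_path k : A :=
  if k is j.+1 then E (N - k) ** last_path j else V N.
Fixpoint last_path' k : A :=
  if k is j.+1 then last_path' j ** E' (N - k) else V N.

(** The matrix entry of the edge e at the vertex l = N - k - 1, once v_l and
v_{l+1} are identified; the entry of the loop is [last_path k ** E N], with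
v_l identified with v_0.  Both are built from the edges at the vertices after
l, and they form an invertible row ([row_isom], [row_unit], [row_orth],
[column_orth]). *)
Definition twisted_E k := twist (V (N - k)) (last_path k) (last_path' k) (F N).
Definition twisted_E' k := twist (V (N - k)) (last_path k) (last_path' k) (F' N).

(** The pair (E_{0,l}, E_{l,0}) of matrix units.  The step multiplies by the
isomorphism of v_l with v_{l+1} described by the chain
  v_l ~ v_l + v_{l+1} ~ v_l + v_{l+1} + ... + v_N ~ v_{l+1} + ... + v_N
      ~ v_{l+1}:
its first arrow is the row (f_l, e_l), and the product of the others is a
column, which is the identity on v_{l+1} off the copy of v_N cut out by
[last_path], and on this copy together with v_l is the inverse of the row
(f_N, e_N).  Both units are defined together because v_l has to be identified
with v_0 before it can be absorbed by v_N. *)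
Fixpoint munits l : A * A :=
  if l is j.+1 then
    let: (g, g') := munits j in let k := (N - l)%N in
    (g ** (E j ** twisted_E' k + F j ** (g' ** E' N ** last_path' k)),
     (twisted_E k ** E' j + (last_path k ** E N ** g) ** F' j) ** g')
  else (V 0, V 0).

Definition munit l := (munits l).1.
Definition munit' l := (munits l).2.

Lemma munitS l : munit l.+1 = munit l ** (E l ** twisted_E' (N - l.+1) +
  F l ** (munit' l ** E' N ** last_path' (N - l.+1))).
Proof. by rewrite /munit /munit' /=; case: munits. Qed.

Lemma munit'S l : munit' l.+1 = (twisted_E (N - l.+1) ** E' l +
  (last_path (N - l.+1) ** E N ** munit l) ** F' l) ** munit' l.
Proof. by rewrite /munit /munit' /=; case: munits. Qed.

Hypothesis fam : lpa_family v ed gh.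

Let ordSE l : (l < N)%N -> ordS (inord l : 'I_N.+1) = inord l.+1.
Proof.
by move=> lN; apply: val_inj; rewrite /= !inordK ?modn_small // ltnS ltnW.
Qed.

Let ordSN : ordS (inord N : 'I_N.+1) = inord 0.
Proof. by apply: val_inj; rewrite /= !inordK // modnn. Qed.

Let VV l : V l ** V l = V l.
Proof. by rewrite (gfam_vv fam) eqxx. Qed.
Let VE l : V l ** E l = E l. Proof. exact: (gfam_ve fam (inl (inord l))). Qed.
Let VF l : V l ** F l = F l. Proof. exact: (gfam_ve fam (inr (inord l))). Qed.
Let E'V l : E' l ** V l = E' l. Proof. exact: (gfam_gv fam (inl (inord l))). Qed.
Lemma F'V l : F' l ** V l = F' l. Proof. exact: (gfam_gv fam (inr (inord l))). Qed.
Lemma FV l : F l ** V l = F l. Proof. exact: (gfam_ev fam (inr (inord l))). Qed.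
Let VF' l : V l ** F' l = F' l. Proof. exact: (gfam_vg fam (inr (inord l))). Qed.
Let EV l : (l < N)%N -> E l ** V l.+1 = E l.
Proof. by move=> lN; rewrite -ordSE //; exact: (gfam_ev fam (inl _)). Qed.
Let VE' l : (l < N)%N -> V l.+1 ** E' l = E' l.
Proof. by move=> lN; rewrite -ordSE //; exact: (gfam_vg fam (inl _)). Qed.
Lemma ENV : E N ** V 0 = E N.
Proof. by rewrite -ordSN; exact: (gfam_ev fam (inl _)). Qed.
Lemma VE'N : V 0 ** E' N = E' N.
Proof. by rewrite -ordSN; exact: (gfam_vg fam (inl _)). Qed.
Let E'E l : (l < N)%N -> E' l ** E l = V l.+1.
Proof. by move=> lN; rewrite (gfam_ge fam) eqxx /= ordSE. Qed.
Let E'EN : E' N ** E N = V 0.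
Proof. by rewrite (gfam_ge fam) eqxx /= ordSN. Qed.
Let F'F l : F' l ** F l = V l.
Proof. by rewrite (gfam_ge fam) eqxx. Qed.
Let E'F l : E' l ** F l = 0.
Proof. by rewrite (gfam_ge fam). Qed.
Let F'E l : F' l ** E l = 0.
Proof. by rewrite (gfam_ge fam). Qed.
Let CK l : E l ** E' l + F l ** F' l = V l.
Proof.
pose s : seq (edge C) := [:: inl (inord l); inr (inord l)].
rewrite (gfam_ck2 fam (s := s)) //; last first.
  by case=> j; rewrite !inE /= ?orbF //= -[RHS](inj_eq (@inl_inj _ 'I_N.+1)).
by rewrite !big_cons big_nil addr0.
Qed.

Lemma V_path k : V (N - k) ** last_path k = last_path k.
Proof. by case: k => [|k] /=; rewrite ?subn0 ?VV // numulA VE. Qed.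
Lemma path'_V k : last_path' k ** V (N - k) = last_path' k.
Proof. by case: k => [|k] /=; rewrite ?subn0 ?VV // -numulA E'V. Qed.
Lemma path_V k : last_path k ** V N = last_path k.
Proof. by elim: k => [|k IH] /=; rewrite ?VV // -numulA IH. Qed.
Lemma V_path' k : V N ** last_path' k = last_path' k.
Proof. by elim: k => [|k IH] /=; rewrite ?VV // numulA IH. Qed.

Let path'_path k : (k <= N)%N -> last_path' k ** last_path k = V N.
Proof.
elim: k => [|k IH] kN /=; first exact: VV.
have h : (N - k.+1 < N)%N by rewrite ltn_subrL (leq_ltn_trans _ kN).
rewrite numulA -[_ ** _ ** E _]numulA E'E // -numulA subnSK // V_path.
by apply: IH; exact: ltnW.
Qed.

Section Row.
Variable k : nat.
Hypothesis kN : (k <= N)%N.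
Let w := V (N - k).
Let z := last_path k.
Let z' := last_path' k.

Let ww : w ** w = w := VV _.
Let wz : w ** z = z := V_path _.
Let z'w : z' ** w = z' := path'_V _.
Let z'z : z' ** z = V N := path'_path kN.
Let zp : z ** V N = z := path_V _.
Let pz' : V N ** z' = z' := V_path' _.

Lemma row_isom : twisted_E' k ** twisted_E k = w.
Proof. by rewrite (twistM ww wz z'w z'z zp pz' _ (F'V N)) F'F twist_id. Qed.

Lemma row_unit : twisted_E k ** twisted_E' k + z ** (E N ** E' N) ** z' = w.
Proof.
by rewrite (twistM ww wz z'w z'z zp pz' _ (FV N)) twistD addrC CK twist_id.
Qed.

Lemma row_orth : twisted_E' k ** (z ** E N) = 0.
Proof.
by rewrite numulA (twistl wz z'z zp) -!numulA (numulA _ (V N)) F'V F'E numul0.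
Qed.

Lemma column_orth : (E' N ** z') ** twisted_E k = 0.
Proof.
by rewrite -numulA (twistr z'w z'z pz') !numulA E'V E'F nu0mul.
Qed.
End Row.

(** By induction, since the step is the product of the invertible row
(e_l, f_l) and of an invertible column. *)
Lemma munit_mvn l : (l <= N)%N ->
  [/\ munit l ** munit' l = V 0, munit' l ** munit l = V l,
      munit l ** V l = munit l & V l ** munit' l = munit' l].
Proof.
elim: l => [|l IH] lN; first by rewrite /munit /munit' /= VV.
have [gg' g'g gV Vg'] := IH (ltnW lN); set k := (N - l.+1)%N.
have kN : (k <= N)%N by exact: leq_subr.
have Vk : V (N - k) = V l.+1 by rewrite subKn.
have pp := path'_path kN; have pV := path'_V k; have Vp := V_path k.
rewrite Vk in pV Vp.
have VtE' : V l.+1 ** twisted_E' k = twisted_E' k.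
  by rewrite -Vk; apply: wtwist; [exact: VV | exact: V_path].
have tEV : twisted_E k ** V l.+1 = twisted_E k.
  by rewrite -Vk; apply: twistw; [exact: VV | exact: path'_V].
have tE'V : twisted_E' k ** V l.+1 = twisted_E' k.
  by rewrite -Vk; apply: twistw; [exact: VV | exact: path'_V].
have VtE : V l.+1 ** twisted_E k = twisted_E k.
  by rewrite -Vk; apply: wtwist; [exact: VV | exact: V_path].
have g'V0 : munit' l ** V 0 = munit' l by rewrite -gg' numulA g'g.
have V0g : V 0 ** munit l = munit l by rewrite -gg' -numulA g'g.
set b := munit' l ** E' N ** last_path' k.
set b' := last_path k ** E N ** munit l.
set th := E l ** twisted_E' k + F l ** b.
set th' := twisted_E k ** E' l + b' ** F' l.
have b'b : b' ** b = last_path k ** (E N ** E' N) ** last_path' k.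
  by rewrite /b /b' !numulA -[_ ** munit l ** _]numulA gg' -[_ ** E N ** _]numulA ENV.
have bb' : b ** b' = V l.
  rewrite /b /b' !numulA -[_ ** last_path' k ** _]numulA pp.
  by rewrite -[_ ** E' N ** _]numulA E'V -[_ ** E' N ** _]numulA E'EN g'V0.
have thth' : th ** th' = V l.
  apply: (column_row_mul (w := V l.+1)) => //; [exact: EV | exact: FV | | |].
  - by rewrite row_isom // Vk.
  - by rewrite /b' !numulA -(numulA _ (last_path k)) row_orth // nu0mul.
  - by rewrite /b -!numulA (numulA (E' N)) column_orth // numul0.
have th'th : th' ** th = V l.+1.
  apply: (row_column_mul (v := V l)) => //; first exact: E'E.
  - by rewrite /b !numulA Vg'.
  - by rewrite b'b row_unit // Vk.
rewrite munitS munit'S -/k -/b -/b' -/th -/th'; split.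
- by rewrite numulA -(numulA _ th) thth' gV.
- rewrite numulA -(numulA th') g'g -numulA.
  by rewrite (_ : V l ** th = th) // /th numulDr !numulA VE VF.
- by rewrite -numulA /th numulDl -numulA tE'V /b -!numulA pV.
- by rewrite numulA /th' numulDr !numulA VtE /b' Vp.
Qed.

(** The step of the recursion is [E l ** a + F l ** b]; multiplying it by the
inverse of the column (a, b) gives back the edges, so that up to matrix units
the edges at l < N are expressed by those at the later vertices and by e_N,
f_N. *)
Section Transport.
Variable l : nat.
Hypothesis lN : (l < N)%N.
Let k := (N - l.+1)%N.
Let kN : (k <= N)%N := leq_subr _ _.
Let Vk : V (N - k) = V l.+1. Proof. by rewrite subKn. Qed.

Lemma munit_E : munit l.+1 ** twisted_E k = munit l ** E l.
Proof.
rewrite munitS -/k -numulA numulDl -!numulA row_isom // Vk EV //.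
by rewrite (numulA (E' N)) column_orth // !numul0 addr0.
Qed.

Lemma munit_E' : twisted_E' k ** munit' l.+1 = E' l ** munit' l.
Proof.
rewrite munit'S -/k numulA numulDr !numulA row_isom // Vk VE' //.
by rewrite -(numulA _ (last_path k)) row_orth // !nu0mul addr0.
Qed.

Lemma munit_F : munit l.+1 ** (last_path k ** E N ** munit l) = munit l ** F l.
Proof.
have [gg' g'g gV Vg'] := munit_mvn (ltnW lN).
have g'V0 : munit' l ** V 0 = munit' l by rewrite -gg' numulA g'g.
rewrite munitS -/k -numulA numulDl -!numulA.
rewrite (numulA _ (E N)) (numulA (twisted_E' k)) row_orth // nu0mul numul0 add0r.
rewrite -!numulA (numul_head (path'_path kN)) (numulA (V N)).
by rewrite VE (numul_head E'EN) (numulA _ (V 0)) g'V0 g'g FV.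
Qed.

Lemma munit_F' :
  (munit' l ** E' N ** last_path' k) ** munit' l.+1 = F' l ** munit' l.
Proof.
have [gg' g'g gV Vg'] := munit_mvn (ltnW lN).
have g'V0 : munit' l ** V 0 = munit' l by rewrite -gg' numulA g'g.
rewrite munit'S -/k !numulA numulDr !numulA.
rewrite -!(numulA _ (last_path' k)) path'_path //.
rewrite -(numulA _ (E' N) (_ ** _)) (numulA (E' N)) column_orth // numul0 nu0mul.
by rewrite add0r -(numulA _ (E' N)) E'V -(numulA _ (E' N)) E'EN g'V0 g'g VF'.
Qed.
End Transport.

(** Since e_N goes from v_N to v_0, and v_0 is identified with v_N, the relation
at N becomes that of a module isomorphic to two copies of itself. *)
Definition corner_x (i : 'I_2) :=
  if i == ord0 then munit N ** F N ** munit' N else munit N ** E N.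
Definition corner_y (i : 'I_2) :=
  if i == ord0 then munit N ** F' N ** munit' N else E' N ** munit' N.

Lemma corner_family : leavitt_family corner_x corner_y (V 0).
Proof.
have [gg' g'g gV Vg'] := munit_mvn (leqnn N).
have g'V0 : munit' N ** V 0 = munit' N by rewrite -gg' numulA g'g.
have V0g : V 0 ** munit N = munit N by rewrite -gg' -numulA g'g.
split.
- case=> [[|[|//]] ?] [[|[|//]] ?]; rewrite /corner_x /corner_y /= -!numulA.
  + rewrite (numul_head g'g) (numulA (V N)) VF (numul_head (F'F N)).
    by rewrite Vg' gg'.
  + by rewrite (numul_head g'g) VE F'E numul0.
  + rewrite (numul_head g'g) (numulA (V N)) VF (numul_head (E'F N)).
    by rewrite nu0mul.
  + by rewrite (numul_head g'g) VE E'EN.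
- rewrite !big_ord_recl big_ord0 /corner_x /corner_y /= addr0 -!numulA.
  rewrite (numul_head g'g) (numulA (V N)) VF' -numulDr (numulA (F N)).
  by rewrite (numulA (E N)) -numulDl addrC CK Vg' gg'.
- by case=> [[|[|//]] ?]; rewrite /corner_x /= -numulA ?g'V0 ?ENV.
- by case=> [[|[|//]] ?]; rewrite /corner_y /= !numulA ?V0g ?VE'N.
Qed.

End MatrixUnits.

(** * Elements of L(1,2) *)

Section LeavittTwo.
Variable K : fieldType.
Local Notation L2 := (leavitt_algebra K 2).
Local Notation one := (lv_1 K 2).
Local Notation x0 := (lv_x K (ord0 : 'I_2)).
Local Notation x1 := (lv_x K (ord_max : 'I_2)).
Local Notation y0 := (lv_y K (ord0 : 'I_2)).
Local Notation y1 := (lv_y K (ord_max : 'I_2)).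

Definition xpow k : L2 := iter k (numul x0) one.
Definition ypow k : L2 := iter k (numul^~ y0) one.

Let fam := lv_family K 2.
Let y0x0 : y0 ** x0 = one. Proof. exact: lfam_yx fam _ _. Qed.
Let y0x1 : y0 ** x1 = 0. Proof. exact: lfam_yx fam _ _. Qed.
Let y1x0 : y1 ** x0 = 0. Proof. exact: lfam_yx fam _ _. Qed.
Let y1x1 : y1 ** x1 = one. Proof. exact: lfam_yx fam _ _. Qed.
Let xy : x0 ** y0 + x1 ** y1 = one.
Proof.
rewrite -(lfam_xy fam) !big_ord_recl big_ord0 addr0.
by congr (_ + lv_x _ _ ** lv_y _ _); apply: val_inj.
Qed.

Lemma ypow_xpow k : ypow k ** xpow k = one.
Proof.
elim: k => [|k IH] /=; first exact: lv_mul1l.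
by rewrite numulA -(numulA _ y0) y0x0 lv_mul1r.
Qed.

Lemma xpowSr k : xpow k.+1 = xpow k ** x0.
Proof.
elim: k => [|k IH]; first by rewrite /xpow /= lv_mul1l lv_mul1r.
by rewrite -[RHS]numulA -IH.
Qed.

Lemma ypowSr k : ypow k.+1 = y0 ** ypow k.
Proof.
elim: k => [|k IH]; first by rewrite /ypow /= lv_mul1l lv_mul1r.
by rewrite [RHS]numulA -IH.
Qed.

(** The same formulas as for [twisted_E], computed in L(1,2), where the path
of length k to vertex N becomes the kth power of x0. *)
Definition row_e k := twist one (xpow k) (ypow k) x0.
Definition row_e' k := twist one (xpow k) (ypow k) y0.
Definition row_f k := xpow k ** x1.
Definition row_f' k := y1 ** ypow k.

Section RowLaws.
Variable k : nat.
Let u1 := lv_mul1l one.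
Let u2 := lv_mul1l (xpow k).
Let u3 := lv_mul1r (ypow k).
Let u4 := ypow_xpow k.
Let u5 := lv_mul1r (xpow k).
Let u6 := lv_mul1l (ypow k).

Lemma row_e_isom : row_e' k ** row_e k = one.
Proof. by rewrite (twistM u1 u2 u3 u4 u5 u6) ?lv_mul1r // y0x0 twist_id. Qed.

Lemma row_f_isom : row_f' k ** row_f k = one.
Proof. by rewrite numulA -(numulA y1) u4 lv_mul1r y1x1. Qed.

Lemma row_ef : row_e' k ** row_f k = 0.
Proof.
rewrite numulA (twistl u2 u4 u5) lv_mul1r.
by rewrite -numulA y0x1 numul0.
Qed.

Lemma row_fe : row_f' k ** row_e k = 0.
Proof. by rewrite -numulA (twistr u3 u4 u6) lv_mul1l numulA y1x0 nu0mul. Qed.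

Lemma row_sum : row_e k ** row_e' k + row_f k ** row_f' k = one.
Proof.
rewrite (twistM u1 u2 u3 u4 u5 u6) ?lv_mul1r // /row_f /row_f' -numulA.
by rewrite (numulA x1) (numulA _ (x1 ** y1)) twistD xy twist_id.
Qed.

(** This is why the path of length k becomes the kth power of x0. *)
Lemma row_e_xpow : row_e k ** xpow k = xpow k.+1.
Proof. by rewrite (twistl u2 u4 u5) lv_mul1r xpowSr. Qed.

Lemma ypow_row_e' : ypow k ** row_e' k = ypow k.+1.
Proof. by rewrite (twistr u3 u4 u6) lv_mul1l ypowSr. Qed.
End RowLaws.

Section Code.
Variable N : nat.

(** The N + 1 isometries of a complete prefix code, an isomorphism of the free
module of rank 1 with that of rank N + 1. *)
Definition code l := if (l < N)%N then xpow l ** x1 else xpow N.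
Definition code' l := if (l < N)%N then y1 ** ypow l else ypow N.

Lemma ypow_xpow_sub i j : (i <= j)%N -> ypow i ** xpow j = xpow (j - i).
Proof.
elim: i j => [|i IH] [|j] //= ij; rewrite ?lv_mul1l ?subn0 //.
by rewrite subSS -IH // numulA -(numulA _ y0) y0x0 lv_mul1r.
Qed.

Lemma ypow_xpow_subr i j : (i <= j)%N -> ypow j ** xpow i = ypow (j - i).
Proof.
elim: i j => [|i IH] [|j] //= ij; rewrite ?lv_mul1r ?subn0 //.
by rewrite subSS -IH // numulA -(numulA _ y0) y0x0 lv_mul1r.
Qed.

Lemma code_orth i j : (i <= N)%N -> (j <= N)%N ->
  code' i ** code j = if i == j then one else 0.
Proof.
have xS a : y1 ** xpow a.+1 = 0 by rewrite numulA y1x0 nu0mul.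
have yS a : ypow a.+1 ** x1 = 0 by rewrite -numulA y0x1 numul0.
rewrite /code /code' => iN jN.
have [ij|ji|<-] := ltngtP i j.
- have -> : (i < N)%N by exact: leq_trans ij jN.
  have yx a : (i < a)%N -> y1 ** ypow i ** xpow a = 0.
    by move=> ia; rewrite -numulA ypow_xpow_sub ?(ltnW ia) // -(subnSK ia) xS.
  by case: ifP => _; rewrite ?numulA yx ?nu0mul // (leq_trans ij).
- have -> : (j < N)%N by exact: leq_trans ji iN.
  have yx a : (j < a)%N -> ypow a ** xpow j ** x1 = 0.
    by move=> ja; rewrite ypow_xpow_subr ?(ltnW ja) // -(subnSK ja) yS.
  case: ifP => _; first by rewrite -!numulA (numulA _ _ x1) yx ?numul0.
  by rewrite numulA yx // (leq_trans ji).
- case: ifP => _; last exact: ypow_xpow.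
  by rewrite numulA -(numulA y1) ypow_xpow lv_mul1r y1x1.
Qed.

Lemma code_sum : \sum_(i < N.+1) code i ** code' i = one.
Proof.
have H m : \sum_(i < m) xpow i ** x1 ** (y1 ** ypow i) = one - xpow m ** ypow m.
  elim: m => [|m IH]; first by rewrite big_ord0 /= lv_mul1l subrr.
  rewrite xpowSr ypowSr big_ord_recr IH /=.
  rewrite -!numulA (numulA x1) (numulA x0).
  have -> : x1 ** y1 = one - x0 ** y0 by rewrite -xy addrAC subrr add0r.
  by rewrite numulBl numulBr lv_mul1l addrA subrK.
rewrite big_ord_recr /= {2}/code {2}/code' ltnn.
rewrite -[RHS](subrK (xpow N ** ypow N)) -H; congr (_ + _).
by apply: eq_bigr => i _; rewrite /code /code' ltn_ord.
Qed.
End Code.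
End LeavittTwo.

(** * The Leavitt path family in L(1,2) *)

(** A representation by matrices whose entries are [one] at the vertices and
[c], [c'] at the edges, transported by isometries [s] with orthogonal ranges:
the relations reduce to those of the entries. *)
Section CodeFamily.
Variables (K : comPzRingType) (A : nuAlgType K) (E : digraph) (one : A).
Variables (s s' : vertex E -> A) (c c' : edge E -> A).
Hypothesis oner : forall a, a ** one = a.
Hypothesis s's : forall i j, s' i ** s j = if i == j then one else 0.
Hypothesis c'c : forall a b, src a = src b -> c' a ** c b = if a == b then one else 0.
Hypothesis cc' : forall i (t : seq (edge E)), uniq t -> t <> [::] ->
  (forall a, (a \in t) = (src a == i)) -> \sum_(a <- t) c a ** c' a = one.

Lemma code_lpa_family : lpa_family (fun i => s i ** s' i)
  (fun a => s (src a) ** c a ** s' (tgt a))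
  (fun a => s (tgt a) ** c' a ** s' (src a)).
Proof.
have s'sK i : s' i ** s i = one by rewrite s's eqxx.
split=> [i j|a|a|a|a|a b|i t ut t0 tE].
- rewrite !numulA -(numulA _ (s' i)) s's.
  by case: eqP => [->|_]; rewrite ?oner // numul0 nu0mul.
- by rewrite !numulA -(numulA _ _ (s _)) s'sK oner.
- by rewrite !numulA -(numulA _ _ (s _)) s'sK oner.
- by rewrite !numulA -(numulA _ _ (s _)) s'sK oner.
- by rewrite !numulA -(numulA _ _ (s _)) s'sK oner.
- rewrite !numulA -(numulA _ _ (s (src b))) s's.
  have [ab|ab] := eqVneq (src a) (src b); last first.
    rewrite numul0 !nu0mul; case: eqP => // e; by rewrite e eqxx in ab.
  rewrite oner -(numulA _ (c' a)) c'c //.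
  by case: eqP => [->|_]; rewrite ?oner // numul0 nu0mul.
- rewrite -[s i]oner -(cc' ut t0 tE) numul_sumr numul_suml.
  rewrite !big_seq; apply: eq_bigr => a; rewrite tE => /eqP <-.
  by rewrite !numulA -[_ ** s' _ ** s _]numulA s'sK oner.
Qed.
End CodeFamily.

(** * Naturality of the matrix units *)

Section Naturality.
Variables (K : comPzRingType) (A B : nuAlgType K) (f : {linear A -> B}).
Hypothesis fM : multiplicative_map f.

Lemma map_twist w z z' a : f (twist w z z' a) = twist (f w) (f z) (f z') (f a).
Proof. by rewrite /twist linearD linearB /= !fM. Qed.

Variable N : nat.
Local Notation C := (C0 N.+1).
Variables (v : vertex C -> A) (e g : edge C -> A).
Variables (v1 : vertex C -> B) (e1 g1 : edge C -> B).
Hypotheses (fv : forall i, f (v i) = v1 i) (fe : forall a, f (e a) = e1 a)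
           (fg : forall a, f (g a) = g1 a).

Lemma map_path k : f (last_path v e k) = last_path v1 e1 k.
Proof. by elim: k => [|k IH] /=; rewrite ?fv // fM fe IH. Qed.

Lemma map_path' k : f (last_path' v g k) = last_path' v1 g1 k.
Proof. by elim: k => [|k IH] /=; rewrite ?fv // fM fg IH. Qed.

Lemma map_munit l : f (munit v e g l) = munit v1 e1 g1 l
  /\ f (munit' v e g l) = munit' v1 e1 g1 l.
Proof.
elim: l => [|l [IH IH']]; first by rewrite /munit /munit' /= !fv.
rewrite !munitS !munit'S /twisted_E /twisted_E' !fM !linearD /= !fM !map_twist.
by rewrite !(IH, IH', map_path, map_path', fv, fe, fg).
Qed.
End Naturality.

(** * The cycle with loops in L(1,2) *)

Section CycleCode.
Variables (K : fieldType) (N : nat).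
Local Notation L2 := (leavitt_algebra K 2).
Local Notation one := (lv_1 K 2).
Local Notation x0 := (lv_x K (ord0 : 'I_2)).
Local Notation x1 := (lv_x K (ord_max : 'I_2)).
Local Notation y0 := (lv_y K (ord0 : 'I_2)).
Local Notation y1 := (lv_y K (ord_max : 'I_2)).
Local Notation C := (C0 N.+1).

Definition coef (a : edge C) : L2 :=
  match a with
  | inl i => if (i < N)%N then row_e K (N - i.+1) else x1
  | inr i => if (i < N)%N then row_f K (N - i.+1) else x0
  end.

Definition coef' (a : edge C) : L2 :=
  match a with
  | inl i => if (i < N)%N then row_e' K (N - i.+1) else y1
  | inr i => if (i < N)%N then row_f' K (N - i.+1) else y0
  end.

Lemma coef_orth a b : src a = src b ->
  coef' a ** coef b = if a == b then one else 0.
Proof.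
have fam := lv_family K 2.
case: a b => [i|i] [j|j] /= <-; rewrite ?(inj_eq (@inl_inj _ _)) ?(inj_eq (@inr_inj _ _)) ?eqxx.
- case: ifP => _; first exact: row_e_isom.
  exact: lfam_yx fam _ _.
- case: ifP => _; first exact: row_ef.
  exact: lfam_yx fam _ _.
- case: ifP => _; first exact: row_fe.
  exact: lfam_yx fam _ _.
- case: ifP => _; first exact: row_f_isom.
  exact: lfam_yx fam _ _.
Qed.

Lemma coef_sum (i : 'I_N.+1) :
  coef (inl i) ** coef' (inl i) + coef (inr i) ** coef' (inr i) = one.
Proof.
have fam := lv_family K 2.
rewrite /=; case: ifP => _; first exact: row_sum.
rewrite -(lfam_xy fam) !big_ord_recl big_ord0 addr0 addrC.
by congr (_ + lv_x _ _ ** lv_y _ _); apply: val_inj.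
Qed.

Definition code_v (i : vertex C) : L2 := code K N i ** code' K N i.
Definition code_e (a : edge C) : L2 :=
  code K N (src a) ** coef a ** code' K N (tgt a).
Definition code_g (a : edge C) : L2 :=
  code K N (tgt a) ** coef' a ** code' K N (src a).

Lemma code_family : lpa_family code_v code_e code_g.
Proof.
apply: (@code_lpa_family K L2 C one (fun i => code K N i)
  (fun i => code' K N i) coef coef').
- exact: lv_mul1r.
- by move=> i j; rewrite code_orth // -ltnS.
- exact: coef_orth.
- move=> i t ut t0 tE.
  rewrite (perm_big [:: inl i; inr i : edge C]) /=.
    by rewrite !big_cons big_nil addr0 coef_sum.
  apply: uniq_perm => // a; rewrite tE !inE.
  by case: a => j /=; rewrite ?orbF.
Qed.

Let codeK l : (l <= N)%N -> code' K N l ** code K N l = one.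
Proof. by move=> lN; rewrite code_orth // eqxx. Qed.

Let ordK l : (l <= N)%N -> (inord l : 'I_N.+1) = l :> nat.
Proof. by move=> lN; rewrite inordK. Qed.

Let ordSK l : (l < N)%N -> ordS (inord l : 'I_N.+1) = l.+1 :> nat.
Proof. by move=> lN; rewrite /= inordK ?modn_small // ltnS ltnW. Qed.

Let ordSN : ordS (inord N : 'I_N.+1) = 0 :> nat.
Proof. by rewrite /= inordK // modnn. Qed.

Lemma code_path k : (k <= N)%N ->
  last_path code_v code_e k = code K N (N - k) ** xpow K k ** code' K N N.
Proof.
elim: k => [|k IH] kN /=.
  by rewrite /code_v ordK // subn0 lv_mul1r.
have h : (N - k.+1 < N)%N by rewrite ltn_subrL (leq_ltn_trans _ kN).
rewrite IH 1?ltnW // /code_e; cbn [src tgt C0]; rewrite ordSK // subnSK // /coef.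
rewrite ordK ?(ltnW h) // h !numulA -(numulA _ (code' _ _ _) (code _ _ _)).
rewrite codeK ?leq_subr // lv_mul1r -(numulA _ (row_e _ _)).
by rewrite subnSK // subKn 1?ltnW // row_e_xpow /= numulA.
Qed.

Lemma code_path' k : (k <= N)%N ->
  last_path' code_v code_g k = code K N N ** ypow K k ** code' K N (N - k).
Proof.
elim: k => [|k IH] kN /=.
  by rewrite /code_v ordK // subn0 lv_mul1r.
have h : (N - k.+1 < N)%N by rewrite ltn_subrL (leq_ltn_trans _ kN).
rewrite IH 1?ltnW // /code_g; cbn [src tgt C0]; rewrite ordSK // subnSK // /coef'.
rewrite ordK ?(ltnW h) // h !numulA -(numulA _ (code' _ _ _) (code _ _ _)).
rewrite codeK ?leq_subr // lv_mul1r -(numulA _ (ypow _ _)).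
by rewrite subnSK // subKn 1?ltnW // ypow_row_e' /= numulA.
Qed.
Lemma code_last :
  [/\ code_e (inr (inord N)) = code K N N ** x0 ** code' K N N,
      code_g (inr (inord N)) = code K N N ** y0 ** code' K N N,
      code_e (inl (inord N)) = code K N N ** x1 ** code' K N 0 &
      code_g (inl (inord N)) = code K N 0 ** y1 ** code' K N N].
Proof.
rewrite /code_e /code_g; cbn [src tgt C0].
by rewrite ordSN /= ordK // ltnn.
Qed.

(** The entries [coef] are chosen for this: the column in the recursive step is
then inverse to the row ([row_sum]), so that every step is the identity of
L(1,2) up to the code. *)
Lemma code_munit l : (l <= N)%N ->
  munit code_v code_e code_g l = code K N 0 ** code' K N l /\
  munit' code_v code_e code_g l = code K N l ** code' K N 0.
Proof.
elim: l => [|l IH] lN; first by rewrite /munit /munit' /= /code_v ordK.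
have [IH1 IH2] := IH (ltnW lN); set k := (N - l.+1)%N.
have kN : (k <= N)%N := leq_subr _ _.
have Nk : (N - k = l.+1)%N by rewrite subKn.
have vE j : (j <= N)%N -> code_v (inord j) = code K N j ** one ** code' K N j.
  by move=> jN; rewrite /code_v ordK // lv_mul1r.
have [FN F'N EN E'N] := code_last.
have El : code_e (inl (inord l)) = code K N l ** row_e K k ** code' K N l.+1.
  by rewrite /code_e; cbn [src tgt C0]; rewrite ordSK // /= ordK ?lN // ltnW.
have E'l : code_g (inl (inord l)) = code K N l.+1 ** row_e' K k ** code' K N l.
  by rewrite /code_g; cbn [src tgt C0]; rewrite ordSK // /= ordK ?lN // ltnW.
have Fl : code_e (inr (inord l)) = code K N l ** row_f K k ** code' K N l.
  by rewrite /code_e /= ordK ?lN // ltnW.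
have F'l : code_g (inr (inord l)) = code K N l ** row_f' K k ** code' K N l.
  by rewrite /code_g /= ordK ?lN // ltnW.
have cK j : (j <= N)%N -> forall t, code' K N j ** (code K N j ** t) = t.
  by move=> jN t; rewrite numulA codeK // lv_mul1l.
have tw a : twist (code_v (inord (N - k))) (last_path code_v code_e k)
    (last_path' code_v code_g k) (code K N N ** a ** code' K N N) =
    code K N l.+1 ** twist one (xpow K k) (ypow K k) a ** code' K N l.+1.
  rewrite code_path // code_path' // vE Nk //.
  by rewrite twist_conj ?codeK ?lv_mul1r.
rewrite munitS munit'S /twisted_E /twisted_E' -/k FN F'N !tw -/(row_e K k) -/(row_e' K k).
rewrite IH1 IH2 EN E'N El E'l Fl F'l code_path // code_path' // Nk.
have [rs rfE rf'E] : [/\ row_e K k ** row_e' K k + row_f K k ** row_f' K k = one,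
    xpow K k ** x1 = row_f K k & y1 ** ypow K k = row_f' K k].
  by split=> //; exact: row_sum.
(* Generalized, so that distributivity does not expand the twists. *)
move: (row_e K k) (row_e' K k) (row_f K k) (row_f' K k) rs rfE rf'E.
move=> re re' rf rf' rs rfE rf'E; split.
- rewrite !numulDr -!numulA !cK // ?(ltnW lN) // -numulDr.
  by rewrite (numulA y1) rf'E (numulA re) (numulA rf) -numulDl rs lv_mul1l.
- rewrite !numulDl -!numulA !cK // ?(ltnW lN) // -numulDr.
  by rewrite (numulA (xpow _ _)) rfE (numulA re) (numulA rf) -numulDl rs lv_mul1l.
Qed.

End CycleCode.

(** * The isomorphism *)

(** [chi] is the map from L(1,2) to the corner at v_0. *)
Section Corner.
Variables (K : fieldType) (N : nat) (A : nuAlgType K).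
Local Notation C := (C0 N.+1).
Variables (v : vertex C -> A) (e g : edge C -> A).
Hypothesis fam : lpa_family v e g.
Variable chi : {linear leavitt_algebra K 2 -> A}.
Hypothesis chiM : multiplicative_map chi.
Hypothesis chi1 : chi (lv_1 K 2) = v (inord 0).
Hypothesis chix : forall i, chi (lv_x K i) = corner_x v e g i.
Hypothesis chiy : forall i, chi (lv_y K i) = corner_y v e g i.

Local Notation u := (munit v e g).
Local Notation u' := (munit' v e g).
Local Notation V l := (v (inord l)).

Section Step.
Variable l : nat.
Hypothesis lN : (l < N)%N.
Let k := (N - l.+1)%N.
Hypothesis chiX : u l.+1 ** last_path v e k ** u' N = chi (xpow K k).
Hypothesis chiY : u N ** last_path' v g k ** u' l.+1 = chi (ypow K k).

Let Nk : (N - k = l.+1)%N. Proof. by rewrite subKn. Qed.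

Let uVu : u l.+1 ** V l.+1 ** u' l.+1 = V 0.
Proof. by have [<- _ -> _] := munit_mvn fam lN. Qed.

Lemma chi_row_e : u l ** e (inl (inord l)) ** u' l.+1 = chi (row_e K k).
Proof.
have [_ uN _ _] := munit_mvn fam (leqnn N).
rewrite -munit_E // map_twist // chi1 -chiX -chiY chix /corner_x /=.
by rewrite -uVu twist_conj ?uN ?(path_V fam) ?(FV fam) // /twisted_E -/k Nk.
Qed.

Lemma chi_row_e' : u l.+1 ** g (inl (inord l)) ** u' l = chi (row_e' K k).
Proof.
have [_ uN _ _] := munit_mvn fam (leqnn N).
rewrite -numulA -munit_E' // map_twist // chi1 -chiX -chiY chiy /corner_y /=.
by rewrite -uVu twist_conj ?uN ?(path_V fam) ?(F'V fam) // /twisted_E' -/k Nk numulA.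
Qed.

Lemma chi_row_f : u l ** e (inr (inord l)) ** u' l = chi (row_f K k).
Proof.
have [_ uN _ _] := munit_mvn fam (leqnn N).
have [ul _ _ _] := munit_mvn fam (ltnW lN).
rewrite -munit_F // chiM -chiX chix /corner_x /= -!numulA ul (ENV fam) //.
by rewrite (numulA (u' N)) uN (numulA _ (V N)) (path_V fam).
Qed.

Lemma chi_row_f' : u l ** g (inr (inord l)) ** u' l = chi (row_f' K k).
Proof.
have [_ uN _ _] := munit_mvn fam (leqnn N).
have [ul _ _ _] := munit_mvn fam (ltnW lN).
rewrite -numulA -munit_F' // chiM -chiY chiy /corner_y /= !numulA ul (VE'N fam) //.
by rewrite -(numulA _ (u' N)) uN -(numulA _ (V N)) (V_path' fam).
Qed.
End Step.

(** Descends along the cycle from vertex N: the entries at a vertex involve the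
path from the next vertex to N, and the entry of e_l prolongs this path. *)
Lemma chi_path k : (k <= N)%N ->
  u (N - k) ** last_path v e k ** u' N = chi (xpow K k) /\
  u N ** last_path' v g k ** u' (N - k) = chi (ypow K k).
Proof.
elim: k => [|k IH] kN.
  by rewrite subn0 /= chi1; have [<- _ -> _] := munit_mvn fam (leqnn N).
have [IHx IHy] := IH (ltnW kN).
set l := (N - k.+1)%N; have lS : l.+1 = (N - k)%N by rewrite subnSK.
have lN : (l < N)%N by rewrite lS leq_subr.
have kE : (N - l.+1 = k)%N by rewrite lS subKn 1?ltnW.
have [_ ul uV _] := munit_mvn fam lN.
have re := chi_row_e lN; have re' := chi_row_e' lN.
rewrite kE lS in re re' ul.
rewrite -row_e_xpow -ypow_row_e' !chiM -re // -re' // -IHx -IHy /= -/l; split.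
- by rewrite -!numulA (numulA (u' (N - k))) ul (numulA (V _)) (V_path fam) !numulA.
- by rewrite !numulA -(numulA _ (u' (N - k))) ul -(numulA _ _ (V _)) (path'_V fam).
Qed.

Lemma chi_coef (a : edge C) :
  u (src a) ** e a ** u' (tgt a) = chi (coef K a) /\
  u (tgt a) ** g a ** u' (src a) = chi (coef' K a).
Proof.
have ulast (i : 'I_N.+1) : (i < N)%N = false -> i = N :> nat.
  by move=> iN; apply/eqP; rewrite eqn_leq -ltnS ltn_ord leqNgt iN.
have step (i : 'I_N.+1) : (i < N)%N ->
    u i.+1 ** last_path v e (N - i.+1) ** u' N = chi (xpow K (N - i.+1)) /\
    u N ** last_path' v g (N - i.+1) ** u' i.+1 = chi (ypow K (N - i.+1)).
  by move=> iN; have := chi_path (leq_subr i.+1 N); rewrite subKn.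
have iE (i : 'I_N.+1) : inord i = i by exact: inord_val.
have [_ _ uN _] := munit_mvn fam (leqnn N).
case: a => i; cbn [src tgt C0]; rewrite /coef /coef'; case: ifP => iN.
- have [hx hy] := step i iN.
  have -> : ordS i = i.+1 :> nat by rewrite /= modn_small.
  by rewrite -chi_row_e // -chi_row_e' // iE.
- have {}iN := ulast _ iN; have iEN : i = inord N by apply: val_inj; rewrite /= inordK.
  have -> : ordS i = 0 :> nat by rewrite /= iN modnn.
  rewrite iN iEN chix chiy /corner_x /corner_y /=.
  by rewrite /munit {2}/munit' /= -numulA (ENV fam) (VE'N fam).
- have [hx hy] := step i iN.
  by rewrite -chi_row_f // -chi_row_f' // iE.
- have {}iN := ulast _ iN; have iEN : i = inord N by apply: val_inj; rewrite /= inordK.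
  by rewrite iN iEN chix chiy.
Qed.
End Corner.

Section Isomorphism.
Variables (K : fieldType) (N : nat).
Local Notation C := (C0 N.+1).
Local Notation L := (leavitt_path_algebra K C).
Local Notation L2 := (leavitt_algebra K 2).
Local Notation one := (lv_1 K 2).
Local Notation v := (@lpa_v K C).
Local Notation e := (@lpa_e K C).
Local Notation g := (@lpa_g K C).
Local Notation u := (munit v e g).
Local Notation u' := (munit' v e g).
Local Notation s := (code K N).
Local Notation s' := (code' K N).

Let fam := lpa_family_gen K C.

Lemma lpa_cycle_unit (a : L) :
  (\sum_i v i) ** a = a /\ a ** (\sum_i v i) = a.
Proof.
have vl i (b : L) : v i ** b = b -> (\sum_i v i) ** b = b.
  move=> ib; rewrite -{1}ib numulA numul_suml (bigD1 i) //= big1 => [|j ji].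
    by rewrite addr0 (gfam_vv fam) eqxx.
  by rewrite (gfam_vv fam) (negbTE ji).
have vr i (b : L) : b ** v i = b -> b ** (\sum_i v i) = b.
  move=> ib; rewrite -{1}ib -numulA numul_sumr (bigD1 i) //= big1 => [|j ji].
    by rewrite addr0 (gfam_vv fam) eqxx.
  by rewrite (gfam_vv fam) eq_sym (negbTE ji).
elim/lpa_ind: a => [i|a|a||a b [al ar] [bl br]|k a [al ar]|a b [al ar] [bl br]].
- by split; [apply: (vl i) | apply: (vr i)]; rewrite (gfam_vv fam) eqxx.
- by split; [apply: vl (gfam_ve fam a) | apply: vr (gfam_ev fam a)].
- by split; [apply: vl (gfam_vg fam a) | apply: vr (gfam_gv fam a)].
- by rewrite numul0 nu0mul.
- by rewrite numulDl numulDr al ar bl br.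
- by rewrite numulZl numulZr al ar.
- by rewrite numulA al -numulA br.
Qed.

Variable phi : {linear L -> L2}.
Hypothesis phiM : multiplicative_map phi.
Hypothesis phi_v : forall i, phi (v i) = code_v K i.
Hypothesis phi_e : forall a, phi (e a) = code_e K a.
Hypothesis phi_g : forall a, phi (g a) = code_g K a.
Variable chi : {linear L2 -> L}.
Hypothesis chiM : multiplicative_map chi.
Hypothesis chi1 : chi one = v (inord 0).
Hypothesis chix : forall i, chi (lv_x K i) = corner_x v e g i.
Hypothesis chiy : forall i, chi (lv_y K i) = corner_y v e g i.

Let code_eq (i j : 'I_N.+1) : s' i ** s j = if i == j then one else 0.
Proof. by rewrite code_orth // -ltnS. Qed.

Let u_facts (i : 'I_N.+1) : [/\ u i ** u' i = v (inord 0), u' i ** u i = v i,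
  u i ** v i = u i & v i ** u' i = u' i].
Proof.
have iN : (i <= N)%N by rewrite -ltnS.
by have := munit_mvn fam iN; rewrite inord_val.
Qed.

(** The (i,j) entry of the matrix of [a] is the same whether it is read in
L(1,2) or in the corner at v_0.  Both sides are multiplicative as matrices,
so it suffices to compare them on the generators. *)
Lemma chi_phi a (i j : 'I_N.+1) : chi (s' i ** phi a ** s j) = u i ** a ** u' j.
Proof.
have gen (p q : 'I_N.+1) (b : L) c : v p ** b = b -> b ** v q = b ->
    phi b = s p ** c ** s' q -> chi c = u p ** b ** u' q ->
    forall i j : 'I_N.+1, chi (s' i ** phi b ** s j) = u i ** b ** u' j.
  move=> pb bq -> cb {}i {}j; rewrite !numulA code_eq -(numulA _ (s' q)) code_eq.
  have [_ _ <- _] := u_facts i; have [_ _ _ <-] := u_facts j.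
  rewrite -pb -bq !numulA -(numulA (u i) (v i)) -(numulA _ (v q) (v j)).
  rewrite !(gfam_vv fam) (eq_sym q j).
  have [->|_] := eqVneq i p; last by rewrite !nu0mul numul0 !nu0mul linear0.
  have [->|_] := eqVneq j q; last by rewrite !numul0 nu0mul linear0.
  have [_ _ up _] := u_facts p; have [_ _ _ uq] := u_facts q.
  by rewrite lv_mul1l lv_mul1r cb -!numulA uq !numulA up.
elim/lpa_ind: a i j => [l|a|a||a b IHa IHb|k a IHa|a b IHa IHb] i j.
- apply: (gen l l _ one); rewrite ?(gfam_vv fam) ?eqxx //.
    by rewrite phi_v lv_mul1r.
  by rewrite chi1; have [<- _ -> _] := u_facts l.
- apply: gen (gfam_ve fam a) (gfam_ev fam a) (phi_e a) _ i j.
  by have [<-] := chi_coef fam chiM chi1 chix chiy a.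
- apply: gen (gfam_vg fam a) (gfam_gv fam a) (phi_g a) _ i j.
  by have [_ <-] := chi_coef fam chiM chi1 chix chiy a.
- by rewrite !linear0 !numul0 !nu0mul linear0.
- by rewrite !linearD /= !(numulDl, numulDr) linearD /= IHa IHb.
- by rewrite !linearZ /= !(numulZl, numulZr) linearZ /= IHa.
- rewrite phiM -[phi a]lv_mul1r -(code_sum K N) numul_sumr numul_suml.
  rewrite numul_sumr numul_suml linear_sum /=.
  have [_ {2}<-] := lpa_cycle_unit a.
  rewrite numul_sumr numul_suml numul_sumr numul_suml.
  apply: eq_bigr => l _; have [_ <- _ _] := u_facts l.
  transitivity (chi (s' i ** phi a ** s l) ** chi (s' l ** phi b ** s j)).
    by rewrite -chiM !numulA.
  by rewrite IHa IHb !numulA.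
Qed.

Let phi_u (i : 'I_N.+1) : phi (u i) = s 0 ** s' i /\ phi (u' i) = s i ** s' 0.
Proof.
have iN : (i <= N)%N by rewrite -ltnS.
have [-> ->] := map_munit phiM phi_v phi_e phi_g i.
exact: code_munit.
Qed.

(** [phi] sends the matrix units to s_0 s'_l, and therefore the corner at v_0 to
the corner of s_0 s'_0. *)
Lemma phi_chi t : phi (chi t) = s 0 ** t ** s' 0.
Proof.
have codeK l : (l <= N)%N -> s' l ** s l = one by move=> lN; rewrite code_orth // eqxx.
have [pu pu'] := phi_u ord_max; rewrite /= in pu pu'.
have [FN F'N EN E'N] := code_last K N.
have ord2 (P : 'I_2 -> Prop) : P ord0 -> P ord_max -> forall i, P i.
  move=> P0 P1 [[|[|//]] h]; first by rewrite (_ : Ordinal h = ord0) //; exact: val_inj.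
  by rewrite (_ : Ordinal h = ord_max) //; exact: val_inj.
elim/leavitt_ind: t => [||||k a IHa|a b IHa IHb].
- apply: ord2; rewrite chix /corner_x /= !phiM phi_e pu ?pu' ?FN ?EN.
    by rewrite !numulA -!(numulA _ (s' N)) codeK // !lv_mul1r.
  by rewrite !numulA -!(numulA _ (s' N)) codeK // !lv_mul1r.
- apply: ord2; rewrite chiy /corner_y /= !phiM phi_g ?pu pu' ?F'N ?E'N.
    by rewrite !numulA -!(numulA _ (s' N)) codeK // !lv_mul1r.
  by rewrite !numulA -!(numulA _ (s' N)) codeK // !lv_mul1r.
- by rewrite chi1 phi_v /code_v inordK // lv_mul1r.
- by move=> a b IHa IHb; rewrite !linearD /= IHa IHb numulDr numulDl.
- by rewrite !linearZ /= IHa numulZr numulZl.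
- by rewrite chiM phiM IHa IHb !numulA -(numulA _ (s' 0)) codeK // lv_mul1r.
Qed.

(** The inverse recovers an element from the matrix of its entries. *)
Lemma phi_bijective : bijective phi.
Proof.
pose psi (t : L2) : L := \sum_(i < N.+1) \sum_(j < N.+1) u' i ** chi (s' i ** t ** s j) ** u j.
exists psi => [a|t].
- transitivity ((\sum_i v i) ** a ** (\sum_i v i)); last first.
    by have [-> ->] := lpa_cycle_unit a.
  rewrite !numul_suml; apply: eq_bigr => i _.
  rewrite numul_sumr; apply: eq_bigr => j _.
  rewrite chi_phi !numulA; have [_ -> _ _] := u_facts i.
  by rewrite -!numulA; have [_ -> _ _] := u_facts j.
- rewrite -[RHS]lv_mul1l -[RHS]lv_mul1r -(code_sum K N).
  rewrite !numul_suml linear_sum; apply: eq_bigr => i _ /=.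
  rewrite numul_sumr linear_sum; apply: eq_bigr => j _ /=.
  rewrite !phiM phi_chi; have [_ ->] := phi_u i; have [-> _] := phi_u j.
  have s0 : s' 0 ** s 0 = one by rewrite code_orth.
  rewrite !numulA -(numulA _ (s' 0)) s0 lv_mul1r -(numulA _ (s' 0)) s0 lv_mul1r.
  by [].
Qed.

End Isomorphism.

Theorem proposition3p3 (K : fieldType) (n : nat) (hn : (1 <= n)%N) :
  alg_isomorphic (leavitt_path_algebra K (C0 n)) (leavitt_algebra K 2).
Proof.
case: n hn => [//|N] _.
have [phi [phiM phi_v phi_e phi_g]] := lpa_lift (code_family K N).
have [chi [chiM chi1 chix chiy]] :=
  leavitt_lift (corner_family (lpa_family_gen K (C0 N.+1))).
exists phi; split; last exact: phiM.
exact (phi_bijective phiM phi_v phi_e phi_g chiM chi1 chix chiy).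
Qed.
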